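(* Let $0<p\le q<\infty$, and let $u:\mathbb{R}_+\to\mathbb{R}_+$ and $w:\mathbb{R}^2_+\to\mathbb{R}_+$ be two weight functions. The following conditions are equivalent: 1. $\Lambda_2^p(w)\subset\Lambda^q(\mathbb{R}^2,u)$. 2. $\displaystyle C=\sup_{D\in\Delta_d}\frac{\left(\int_0^{|D|}u(\theta)\,d\theta\right)^{1/q}}{\left(\int_Dw(s,t)\,ds\,dt\right)^{1/p}}<\infty$. Moreover, $C$ is the best constant for the embedding in 1.
   Context: As domains, $\mathbb{R}_+=(0,\infty)$ and $\mathbb{R}^2_+=(0,\infty)^2$. A weight is a non-negative locally integrable function. For a measurable $f$ on $\mathbb{R}^n$, $f^*(t)=\inf\{\sigma:|\{x:|f(x)|>\sigma\}|\le t\}$, $t>0$. For measurable $f:\mathbb{R}^2\to\mathbb{R}$, written $f(x,y)$, $f_y^*(x,t)$ is the decreasing rearrangement of $f(x,\cdot)$ evaluated at $t$ (with $x$ fixed), a subscript $x$ on a star denotes the decreasing rearrangement with respect to the first variable, and $f^*_{yx}(s,t)=(f_y^*(\cdot,t))^*_x(s)$. $\Lambda^q(\mathbb{R}^2,u)$ is the set of measurable $f:\mathbb{R}^2\to\mathbb{R}$ with $\|f\|_{\Lambda^q(\mathbb{R}^2,u)}=\left(\int_0^\infty(f^*(t))^qu(t)\,dt\right)^{1/q}<\infty$. $\Lambda_2^p(w)$ is the set of measurable $f:\mathbb{R}^2\to\mathbb{R}$ with $\|f\|_{\Lambda_2^p(w)}=\left(\int_{\mathbb{R}^2_+}(f^*_{yx}(s,t))^pw(s,t)\,ds\,dt\right)^{1/p}<\infty$.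 $\Delta_d$ is the family of decreasing sets: $D\subset\mathbb{R}^2_+$ belongs to $\Delta_d$ if $\chi_D$ is decreasing (non-increasing) in each variable; $|D|$ is the Lebesgue measure of $D$. The inclusion in 1 is an embedding: there is a finite constant $c$ with $\|f\|_{\Lambda^q(\mathbb{R}^2,u)}\le c\,\|f\|_{\Lambda_2^p(w)}$ for all measurable $f$; the best constant is the least such $c$. *)

(* Defs.v *)
From HB Require Import structures.
From mathcomp Require Import all_boot all_order all_algebra.
From mathcomp Require Import all_classical all_reals all_analysis.

Set Implicit Arguments.
Unset Strict Implicit.
Unset Printing Implicit Defensive.
Import Order.TTheory GRing.Theory Num.Theory.
Import numFieldNormedType.Exports.
Local Open Scope classical_set_scope.
Local Open Scope ring_scope.

(* R and R * R with the sigma-algebras of Lebesgue (not only Borel) measurable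
   sets. The associated measures leb1 and leb2 are the complete Lebesgue
   measures; on an arbitrary set their value is the Lebesgue outer measure. *)
Definition lebR (R : realType) : measurableType _ :=
  caratheodory_type (@wlength R idfun)^*%mu.
Definition lebR2 (R : realType) : measurableType _ :=
  caratheodory_type (@lebesgue_measure R \x @lebesgue_measure R)%E^*%mu.

Definition leb1 (R : realType) : {measure set (lebR R) -> \bar R} :=
  @completed_lebesgue_measure R.
Definition leb2 (R : realType) : {measure set (lebR2 R) -> \bar R} :=
  completed_measure_extension
    (mu := (@lebesgue_measure R \x @lebesgue_measure R)%E).

Section definitions.
Variable R : realType.
Implicit Types (p q c : R) (u : R -> R) (w f : R * R -> R).

Definition quadrant : set (R * R) := [set z | 0 < z.1 /\ 0 < z.2].

Definition weight1 u : Prop :=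
  [/\ forall t : R, 0 < t -> 0 <= u t,
      measurable_fun (`]0, +oo[ : set (lebR R)) (u : lebR R -> R) &
      forall K : set R, compact K -> K `<=` `]0, +oo[ ->
        (\int[leb1 R]_(t in K) `|u t|%:E < +oo)%E].

Definition weight2 w : Prop :=
  [/\ forall z, quadrant z -> 0 <= w z,
      measurable_fun (quadrant : set (lebR2 R)) (w : lebR2 R -> R) &
      forall K : set (R * R), compact K -> K `<=` quadrant ->
        (\int[leb2 R]_(z in K) `|w z|%:E < +oo)%E].

(* Functions take extended real values because f_y^* may be infinite even when
   f is real-valued. The infimum over the empty set is +oo. *)
Definition rearrangement (T : Type) (mu : set T -> \bar R) (f : T -> \bar R)
    (t : R) : \bar R :=
  ereal_inf [set s%:E | s in
    [set s : R | (mu [set x | s%:E < `|f x|] <= t%:E)%E]].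

Definition rearrangement_y f (x t : R) : \bar R :=
  rearrangement (leb1 R) (fun y => (f (x, y))%:E) t.

Definition rearrangement_yx f (s t : R) : \bar R :=
  rearrangement (leb1 R) (fun x => rearrangement_y f x t) s.

Definition norm_Lambda q u f : \bar R :=
  ((\int[leb1 R]_(t in `]0%R, +oo[)
     (rearrangement (leb2 R) (EFin \o f) t `^ q * (u t)%:E)) `^ q^-1)%E.

Definition norm_Lambda2 p w f : \bar R :=
  ((\int[leb2 R]_(z in quadrant)
     (rearrangement_yx f z.1 z.2 `^ p * (w z)%:E)) `^ p^-1)%E.

Definition Lambda q u : set (R * R -> R) :=
  [set f | measurable_fun setT (f : lebR2 R -> R) /\
           (norm_Lambda q u f < +oo)%E].

Definition Lambda2 p w : set (R * R -> R) :=
  [set f | measurable_fun setT (f : lebR2 R -> R) /\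
           (norm_Lambda2 p w f < +oo)%E].

(* The inequality is void when the right-hand norm is infinite; it is restricted
   to Lambda2 because the library's convention 0 * +oo = 0 would give it content
   there for c = 0. *)
Definition embedding_constant p q u w c : Prop :=
  [/\ 0 <= c, Lambda2 p w `<=` Lambda q u &
      forall f, Lambda2 p w f ->
        (norm_Lambda q u f <= c%:E * norm_Lambda2 p w f)%E].

Definition embedding p q u w : Prop := exists c, embedding_constant p q u w c.

Definition decreasing_sets : set (set (R * R)) :=
  [set D | [/\ D `<=` quadrant,
     forall x x' y : R, 0 < x -> x <= x' -> 0 < y ->
       \1_D (x', y) <= \1_D (x, y) :> R &
     forall x y y' : R, 0 < x -> 0 < y -> y <= y' ->
       \1_D (x, y') <= \1_D (x, y) :> R]].

(* Division on \bar R satisfies a / 0 = +oo for a > 0, 0 / 0 = 0 and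
   a / +oo = 0 (also for a = +oo). *)
Definition ratio_sup p q u w : \bar R :=
  ereal_sup [set
    ((\int[leb1 R]_(t in [set t : R | (0 < t)%R /\ t%:E < leb2 R D])
        (u t)%:E) `^ q^-1
     / (\int[leb2 R]_(z in D) (w z)%:E) `^ p^-1)%E | D in decreasing_sets].

Definition best_constant p q u w (C : \bar R) : Prop :=
  exists2 c, C = c%:E & embedding_constant p q u w c /\
    forall c', embedding_constant p q u w c' -> c <= c'.

End definitions.

(* Main.v *)
Require Import Defs.
From mathcomp Require Import all_boot all_order all_algebra.
From mathcomp Require Import all_classical all_reals all_analysis.
From mathcomp Require Import measurable_realfun lra.
Import Order.TTheory GRing.Theory Num.Theory.
Import numFieldNormedType.Exports.
Local Open Scope classical_set_scope.
Local Open Scope ring_scope.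

Set Implicit Arguments.
Unset Strict Implicit.
Unset Printing Implicit Defensive.

(** The condition on decreasing sets is the embedding tested on indicators. If
    [D] is decreasing then it is Lebesgue measurable ([measurable_decreasing]),
    its indicator dominates its own iterated rearrangement
    ([rearrangement_yx_indic_le]), and the rearrangement of the indicator is at
    least one on the interval from zero to the area of [D]
    ([rearrangement_indic_ge]). Hence the ratio of [D] is at most the constant of
    any embedding ([ratio_sup_le]).

    Conversely, for [s >= 0] the level set of [|f|] above [s] and the level set of
    its iterated rearrangement have the same area, and the latter is a decreasing
    set. What is used is that there is a decreasing set with the area of the
    former, on which the iterated rearrangement is at least [s]
    ([level_set_rearrangement]). Its area is computed by applying Fubini's theorem
    twice ([measure_set_rearrangement]), after the level set has been replaced by
    a Borel subset of the same measure ([caratheodory_kernel]). The bound on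
    decreasing sets then compares the weighted measures of the level sets, at
    every height, with a constant [C `^ p] and an exponent [q / p >= 1] after
    raising to the power [p]; Minkowski's inequality integrates these comparisons
    over the height ([level_set_embedding]). The constant obtained is the
    supremum of the ratios, which is therefore the best one. *)

(** * Auxiliary results on integrals and powers *)

(** No measurability is needed: the integral of a nonnegative function is a
    supremum over the simple functions below it. *)
Lemma le_integral_ge0 d (T : measurableType d) (R : realType)
    (mu : {measure set T -> \bar R}) (D : set T) (f g : T -> \bar R) :
  (forall x, D x -> 0 <= f x)%E -> (forall x, D x -> f x <= g x)%E ->
  (\int[mu]_(x in D) f x <= \int[mu]_(x in D) g x)%E.
Proof.
move=> f0 fg; have g0 x : D x -> (0 <= g x)%E.
  by move=> Dx; exact: le_trans (f0 _ Dx) (fg _ Dx).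
rewrite !ge0_integralE//; apply: ge_ereal_sup => _ [h/= hf <-].
apply: ereal_sup_ubound; exists h => // x.
by apply: le_trans (hf x) _; exact: lee_restrict.
Qed.

(** [sum_bool_le] and [sum_bool_ge] compare a number with the number of integer
    levels [k + 1] lying below it; they bound lower Riemann sums of the
    layer-cake formula from above and from below. *)
Lemma sum_bool_le (R : realType) (b : nat -> bool) (h : R) (N : nat) :
  0 <= h -> (forall k, b k -> k.+1%:R <= h) -> \sum_(k < N) (b k)%:R <= h.
Proof.
move=> h0 bh; elim: N => [|N IH]; first by rewrite big_ord0.
rewrite big_ord_recr /=; case: (boolP (b N)) => [bN|_]; last by rewrite addr0.
(* level [N + 1] is reached, and a sum of [N] booleans is at most [N] *)
apply: le_trans (bh _ bN); rewrite -natr1 lerD2r.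
have : \sum_(k < N) (b k)%:R <= \sum_(k < N) 1 :> R.
  by apply: ler_sum => k _; case: (b k).
by rewrite sumr_const card_ord.
Qed.

Lemma sum_bool_ge (R : realType) (b : nat -> bool) (z : R) (N : nat) :
  0 <= z -> z + 1 <= N%:R -> (forall k, k.+1%:R <= z + 1 -> b k) ->
  z <= \sum_(k < N) (b k)%:R.
Proof.
move=> z0 zN zb; pose K := (Num.truncn z).+1.
have [Kz zK] : K%:R <= z + 1 /\ z <= K%:R.
  have /andP[h1 h2] := truncn_itv z0.
  by split; [rewrite -natr1 lerD2r|exact: ltW].
have KN : (K <= N)%N by rewrite -(ler_nat R) (le_trans Kz).
rewrite (le_trans zK)// -(big_mkord xpredT (fun k => (b k)%:R)).
rewrite (big_cat_nat (n := K)) //= -[leLHS]addr0 lerD ?sumr_ge0//.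
rewrite big_mkord -[in leLHS](card_ord K) -sumr_const ler_sum// => k _.
by rewrite zb// (le_trans _ Kz)// ler_nat.
Qed.

Lemma ge0_limn_einf (R : realType) (c : \bar R) (v : (\bar R)^nat) (n0 : nat) :
  (forall n, (n0 <= n)%N -> c <= v n)%E -> (c <= limn_einf v)%E.
Proof.
move=> cv; rewrite limn_einf_lim (cvg_lim _ (@cvg_einfs_sup _ v))//.
apply: le_trans (ereal_sup_ubound (x := einfs v n0) _); last by exists n0.
by apply: le_ereal_inf_tmp => _ [n/= n0n <-]; exact: cv.
Qed.

Lemma limn_einf_le (R : realType) (c : \bar R) (v : (\bar R)^nat) :
  (forall n, v n <= c)%E -> (limn_einf v <= c)%E.
Proof.
move=> cv; rewrite limn_einf_lim (cvg_lim _ (@cvg_einfs_sup _ v))//.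
apply: ge_ereal_sup => _ [n _ <-]; apply: le_trans (cv n).
by apply: ereal_inf_lbound; exists n => /=.
Qed.

Lemma Lnorm_sum_le d (T : measurableType d) (R : realType)
    (mu : {measure set T -> \bar R}) (r : R) (f : nat -> T -> R) (N : nat) :
  1 <= r -> (forall k, measurable_fun setT (f k)) ->
  ('N[mu]_r%:E[EFin \o (fun x => (\sum_(k < N) f k x)%R)] <=
    \sum_(k < N) 'N[mu]_r%:E[EFin \o f k])%E.
Proof.
move=> r1 mf; elim: N => [|N IH].
  rewrite big_ord0 (@eq_Lnorm _ _ _ _ _ _ (cst 0%E)) ?Lnorm0//.
    by rewrite eqe gt_eqF// (lt_le_trans _ r1).
  by move=> x /=; rewrite big_ord0.
rewrite big_ord_recr /=; apply: le_trans (leeD IH (lexx _)).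
rewrite (@eq_Lnorm _ _ _ _ _ _
   (EFin \o ((fun x => \sum_(k < N) f k x) \+ f N)%R)).
  by apply: minkowski_EFin => //; exact: measurable_sum.
by move=> x /=; rewrite big_ord_recr.
Qed.

Lemma integral_indicM d (T : measurableType d) (R : realType)
    (mu : {measure set T -> \bar R}) (A : set T) (u : T -> R) :
  (\int[mu]_(x in A) (u x)%:E = \int[mu]_x (\1_A x * u x)%:E)%E.
Proof.
rewrite integral_mkcond; apply: eq_integral => x _.
by rewrite /patch indicE; case: (x \in A); rewrite ?mul1r ?mul0r.
Qed.

Lemma powRKV (R : realType) (x r : R) : 0 <= x -> r != 0 -> (x `^ r^-1) `^ r = x.
Proof. by move=> x0 r0; rewrite -powRrM mulVf// powRr1. Qed.

Lemma powRVK (R : realType) (x r : R) : 0 <= x -> r != 0 -> (x `^ r) `^ r^-1 = x.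
Proof. by move=> x0 r0; rewrite -powRrM mulfV// powRr1. Qed.

Lemma poweRKV (R : realType) (x : \bar R) (r : R) :
  (0 <= x)%E -> r != 0 -> ((x `^ r^-1) `^ r = x)%E.
Proof. by move=> x0 r0; rewrite -poweRrM mulVf// poweRe1. Qed.

Lemma poweRVK (R : realType) (x : \bar R) (r : R) :
  (0 <= x)%E -> r != 0 -> ((x `^ r) `^ r^-1 = x)%E.
Proof. by move=> x0 r0; rewrite -poweRrM mulfV// poweRe1. Qed.

Lemma le_poweR (R : realType) (r : R) (x y : \bar R) :
  0 <= r -> (0 <= x)%E -> (x <= y)%E -> (x `^ r <= y `^ r)%E.
Proof.
move=> r0 x0 xy; apply: gt0_ler_poweR => //.
  by rewrite in_itv/= x0 leey.
by rewrite in_itv/= (le_trans x0 xy) leey.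
Qed.

(** The case [b = 0] relies on [a / 0 = +oo] for [a > 0] and on [0 / 0 = 0]. *)
Lemma lee_divr (R : realType) (a b : \bar R) (c : R) :
  (0 <= a)%E -> (0 <= b)%E -> (b < +oo)%E -> 0 <= c ->
  (a / b <= c%:E)%E = (a <= c%:E * b)%E.
Proof.
move=> a0 b0 boo c0; case: b b0 boo => [b| |]//.
rewrite lee_fin le_eqVlt => /predU1P[<-|b0] _.
  rewrite inve0 mule0; move: a0; rewrite le_eqVlt => /predU1P[<-|a0].
    by rewrite mul0e lee_fin c0 lexx.
  by rewrite gt0_muley// leye_eq/= leNgt a0.
by rewrite inver gt_eqF// lee_pdivrMr.
Qed.

Lemma measurable_fun_powR d (T : measurableType d) (R : realType) (D : set T)
    (f : T -> R) (r : R) :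
  measurable_fun D f -> measurable_fun D (fun x => f x `^ r).
Proof. exact: (measurableT_comp (@measurable_powR R r)). Qed.

(** * From level sets to functions *)

Section level_sets.
Context {d1 d2} {X : measurableType d1} {Y : measurableType d2} {R : realType}.
Variables (mu : {measure set X -> \bar R}) (nu : {measure set Y -> \bar R}).
Variables (r K : R) (u : X -> R) (w : Y -> R) (F : X -> \bar R) (H : Y -> \bar R).
Variables (J : R -> set X) (D : R -> set Y).
Hypotheses (r1 : 1 <= r) (K0 : 0 <= K).
Hypotheses (meas_u : measurable_fun setT u) (meas_w : measurable_fun setT w).
Hypotheses (u0 : forall x, 0 <= u x) (w0 : forall y, 0 <= w y).
Hypotheses (F0 : forall x, (0 <= F x)%E) (H0 : forall y, (0 <= H y)%E).
Hypotheses (mJ : forall s : R, 0 < s -> measurable (J s))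
  (mD : forall s : R, 0 < s -> measurable (D s)).
Hypotheses (FJ : forall (s : R) x, 0 < s -> (s%:E < F x)%E -> J s x)
  (DH : forall (s : R) y, 0 < s -> D s y -> (s%:E <= H y)%E).
Hypothesis JD : forall s : R, 0 < s ->
  ((\int[mu]_(x in J s) (u x)%:E) `^ r^-1 <=
    K%:E * \int[nu]_(y in D s) (w y)%:E)%E.

(* The [k]-th level of the subdivision of mesh [1 / (n + 1)]. *)
Let level (n k : nat) : R := k.+1%:R / n.+1%:R.

Let level_gt0 n k : 0 < level n k. Proof. by rewrite divr_gt0. Qed.

(* A lower sum for the layer-cake formula. Taking [(n + 1) ^ 2] levels of mesh
   [1 / (n + 1)] makes the highest level [n + 1] tend to infinity, so that
   infinite values of [F] are reached in the limit. *)
Let step (n : nat) (x : X) : R :=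
  \sum_(k < n.+1 ^ 2) n.+1%:R^-1 * \1_(J (level n k)) x.

Let step_ge0 n x : 0 <= step n x.
Proof. by apply: sumr_ge0 => k _; rewrite mulr_ge0// invr_ge0. Qed.

Let r0 : 0 < r. Proof. exact: lt_le_trans r1. Qed.
Let rN0 : r != 0. Proof. by rewrite gt_eqF. Qed.

Let sum_D_le n y :
  ((\sum_(k < n.+1 ^ 2) n.+1%:R^-1 * \1_(D (level n k)) y)%:E <= H y)%E.
Proof.
have := H0 y; case HE : (H y) => [h| |]//= h0; last by rewrite leey.
rewrite lee_fin -mulr_sumr ler_pdivrMl//.
under eq_bigr do rewrite indicE.
apply: (@sum_bool_le _ (fun k => y \in D (level n k))) => [|k]; first by rewrite mulr_ge0.
rewrite inE => /(DH (level_gt0 n k)); rewrite HE lee_fin.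
by rewrite ler_pdivrMr// mulrC.
Qed.

Let step_ge z x : 0 <= z -> (z%:E < F x)%E ->
  exists n0, forall n, (n0 <= n)%N -> z <= step n x.
Proof.
move=> z0 zF.
have [e e0 eF] : exists2 e : R, 0 < e & ((z + e)%:E <= F x)%E.
  case FE : (F x) zF => [f| |]//; last by exists 1; rewrite ?leey.
  by rewrite lte_fin -subr_gt0 => zf; exists (f - z); rewrite ?lee_fin ?subrKC.
pose m := maxn (Num.truncn e^-1) (Num.truncn (z + 1)).
have h1 (n : nat) : (m <= n)%N -> n.+1%:R^-1 < e /\ z + 1 < n.+1%:R.
  rewrite geq_max => /andP[en zn]; split.
    rewrite -[e]invrK ltf_pV2 ?posrE ?invr_gt0//.
    apply: lt_le_trans (truncnS_gt _) _; first by rewrite ler_nat.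
  by apply: lt_le_trans (truncnS_gt _) _; rewrite ler_nat.
exists m => n /h1[ne zn].
rewrite /step -mulr_sumr ler_pdivlMl// mulrC.
under eq_bigr do rewrite indicE.
have n1 : (1 : R) <= n.+1%:R by rewrite ler1n.
apply: (@sum_bool_ge _ (fun k => x \in J (level n k))) => [||k kz].
- by rewrite mulr_ge0.
- by rewrite natrX; nra.
rewrite inE; apply: FJ => //; apply: lt_le_trans eF.
rewrite lte_fin ltr_pdivrMr//.
rewrite (le_lt_trans kz)// mulrDl ltrD2l.
by rewrite -ltr_pdivrMr// div1r.
Qed.

Let Lnorm_term n k :
  ('N[mu]_r%:E[EFin \o (fun x =>
      n.+1%:R^-1 * \1_(J (level n k)) x * u x `^ r^-1)%R] =
  (n.+1%:R^-1)%:E * (\int[mu]_(x in J (level n k)) (u x)%:E) `^ r^-1)%E.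
Proof.
have c0 : 0 <= (n.+1%:R^-1 : R) by [].
have mJk : measurable (J (level n k)) by exact: mJ.
rewrite unlock integral_indicM.
rewrite (eq_integral (fun x => (n.+1%:R^-1 `^ r)%:E *
    (\1_(J (level n k)) x * u x)%:E)%E); last first.
  move=> x _ /=; rewrite ger0_norm; last by rewrite !mulr_ge0// powR_ge0.
  rewrite -EFinM -mulrA !powRM ?mulr_ge0 ?powR_ge0//; congr (_ * _)%:E.
  rewrite powRKV//; congr (_ * _).
  by rewrite indicE; case: (x \in _); rewrite ?powR1 ?powR0.
rewrite ge0_integralZl//; last 2 first.
- by apply/measurable_EFinP; apply: measurable_funM.
- by move=> x _; rewrite lee_fin mulr_ge0.
rewrite poweRM ?lee_fin ?powR_ge0//; last first.
  by apply: integral_ge0 => x _; rewrite lee_fin mulr_ge0.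
by rewrite poweR_EFin powRVK.
Qed.

(* Minkowski's inequality for the sum of the indicators of the sets [J s],
   weighted by [u `^ r^-1], followed by the hypothesis on each level. *)
Let step_bound n :
  (\int[mu]_x (step n x `^ r * u x)%:E <=
    (K%:E * \int[nu]_y (H y * (w y)%:E)) `^ r)%E.
Proof.
pose f k x := n.+1%:R^-1 * \1_(J (level n k)) x * u x `^ r^-1.
have mf k : measurable_fun setT (f k).
  apply: measurable_funM.
    by apply: measurable_funM => //; apply: measurable_indic; exact: mJ.
  exact: measurable_fun_powR.
have -> : (\int[mu]_x (step n x `^ r * u x)%:E =
    'N[mu]_r%:E[EFin \o (fun x => (\sum_(k < n.+1 ^ 2) f k x)%R)] `^ r)%E.
  rewrite poweR_Lnorm//; apply: eq_integral => x _ /=.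
  rewrite -mulr_suml -/(step n x) ger0_norm ?mulr_ge0 ?powR_ge0//.
  by rewrite powRM ?powR_ge0// powRKV.
apply: le_poweR; [exact: ltW|exact: Lnorm_ge0|].
apply: le_trans (Lnorm_sum_le mu _ r1 mf) _.
have wD_ge0 k : (0 <= \int[nu]_(y in D (level n k)) (w y)%:E)%E.
  by apply: integral_ge0 => y _; rewrite lee_fin.
apply: (@le_trans _ _ (\sum_(k < n.+1 ^ 2)
    K%:E * \int[nu]_y (n.+1%:R^-1 * \1_(D (level n k)) y * w y)%:E)%E).
  apply: lee_sum => k _; rewrite Lnorm_term.
  under [X in (_ <= _ * X)%E]eq_integral do rewrite -mulrA EFinM.
  rewrite ge0_integralZl//; last 2 first.
  - by apply/measurable_EFinP; apply: measurable_funM => //;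
      apply: measurable_indic; exact: mD.
  - by move=> y _; rewrite lee_fin mulr_ge0.
  by rewrite -integral_indicM muleCA lee_pmul2l// JD.
rewrite -ge0_sume_distrr//; last first.
  by move=> k _; apply: integral_ge0 => y _; rewrite lee_fin !mulr_ge0.
apply: lee_wpmul2l => //.
rewrite -ge0_integral_sum//; last 2 first.
- move=> k; apply/measurable_EFinP; apply: measurable_funM => //.
  by apply: measurable_funM => //; apply: measurable_indic; exact: mD.
- by move=> k y _; rewrite lee_fin !mulr_ge0.
apply: le_integral_ge0 => y _.
  by apply: sume_ge0 => k _; rewrite lee_fin !mulr_ge0.
by rewrite sumEFin -mulr_suml EFinM lee_wpmul2r ?lee_fin ?sum_D_le.
Qed.

Let step_liminf x :
  (F x `^ r * (u x)%:E <= limn_einf (fun n => (step n x `^ r * u x)%:E))%E.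
Proof.
set L := limn_einf _.
have L0 : (0 <= L)%E.
  by apply: (ge0_limn_einf (n0 := 0)) => n _; rewrite lee_fin mulr_ge0 ?powR_ge0.
have [ux0|ux0] := eqVneq (u x) 0; first by rewrite ux0 mule0.
have {}ux0 : 0 < u x by rewrite lt0r ux0 u0.
rewrite leNgt; apply/negP => LF.
(* a real [l] strictly between [L] and the value, and the number [z < F x] with
   [z `^ r * u x = l] *)
have [l Ll lF] : exists2 l : R, (L < l%:E)%E & (l%:E < F x `^ r * (u x)%:E)%E.
  have Lfin : L \is a fin_num by rewrite ge0_fin_numE// (lt_le_trans LF)// leey.
  move: LF; rewrite -(fineK Lfin); move: (F x `^ r * _)%E => [t| |]//.
    by rewrite lte_fin => Lt; exists ((fine L + t) / 2); rewrite lte_fin midf_lt.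
  by move=> _; exists (fine L + 1); rewrite ?ltry// lte_fin ltrDl.
have l0 : 0 < l by rewrite -lte_fin (le_lt_trans L0).
have lu0 : 0 <= l / u x by rewrite divr_ge0// ltW.
have zF : (((l / u x) `^ r^-1)%:E < F x)%E.
  rewrite ltNge; apply/negP => /(le_poweR (ltW r0) (F0 x)).
  rewrite poweR_EFin powRKV// => Flu.
  have : (F x `^ r * (u x)%:E <= (l / u x)%:E * (u x)%:E)%E.
    by rewrite lee_wpmul2r// lee_fin.
  by rewrite -EFinM divfK ?gt_eqF// leNgt lF.
have [n0 hn0] := step_ge (powR_ge0 _ _) zF.
have : (l%:E <= L)%E.
  apply: (ge0_limn_einf (n0 := n0)) => n /hn0 zn.
  rewrite lee_fin -ler_pdivrMr// -[leLHS](@powRKV _ _ r)//.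
  by rewrite ge0_ler_powR ?nnegrE ?powR_ge0// ltW.
by rewrite leNgt Ll.
Qed.

(** An inequality between the weighted measures of the level sets of [F] and [H]
    passes to the functions when [1 <= r]. Heuristically, [F] is the integral
    over [s > 0] of the indicators of its level sets, and Minkowski's integral
    inequality bounds its norm by the integral of their norms. Here the integral
    is replaced by finite lower sums, and Fatou's lemma passes to the limit. Only
    the inclusions of [{s < F}] in [J s] and of [D s] in [{s <= H}] matter, and
    [F] and [H] need not be measurable. *)
Lemma level_set_embedding :
  ((\int[mu]_x (F x `^ r * (u x)%:E)) `^ r^-1 <=
    K%:E * \int[nu]_y (H y * (w y)%:E))%E.
Proof.
have I0 : (0 <= \int[nu]_y (H y * (w y)%:E))%E.
  by apply: integral_ge0 => y _; rewrite mule_ge0// lee_fin.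
rewrite -[leRHS](@poweRVK _ _ r)//; last by rewrite mule_ge0.
apply: le_poweR; first by rewrite invr_ge0 ltW.
  by apply: integral_ge0 => x _; rewrite mule_ge0 ?poweR_ge0 ?lee_fin.
apply: (@le_trans _ _
   (\int[mu]_x limn_einf (fun n => (step n x `^ r * u x)%:E))%E).
  apply: le_integral_ge0 => x _; last exact: step_liminf.
  by rewrite mule_ge0 ?poweR_ge0 ?lee_fin.
apply: le_trans (fatou mu _ _ _) _ => //.
- move=> n; apply/measurable_EFinP; apply: measurable_funM => //.
  apply: measurable_fun_powR.
  apply: measurable_sum => k; apply: measurable_funM => //.
  by apply: measurable_indic; exact: mJ.
- by move=> n x _; rewrite lee_fin mulr_ge0 ?powR_ge0.
exact: limn_einf_le.
Qed.

End level_sets.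

(** * Measurable hulls and kernels *)

Lemma outer_measure_hull d (T : measurableType d) (R : realType)
    (mu : {measure set T -> \bar R}) (E : set T) :
  (mu^*%mu E < +oo)%E ->
  exists G, [/\ measurable G, E `<=` G & mu G = mu^*%mu E].
Proof.
move=> Efin; have E0 : (0 <= mu^*%mu E)%E by exact: outer_measure_ge0.
have coverE (n : nat) : exists A : set T,
    [/\ measurable A, E `<=` A & (mu A <= mu^*%mu E + (n.+1%:R^-1)%:E)%E].
  have Efn : mu^*%mu E \is a fin_num by rewrite ge0_fin_numE.
  have n0 : 0 < n.+1%:R^-1 :> R by rewrite invr_gt0.
  have [_/= [A [mA EA] <-] /ltW An] := lb_ereal_inf_adherent n0 Efn.
  exists (\bigcup_k A k); split => //; first exact: bigcupT_measurable.
  apply: le_trans An; apply: measure_sigma_subadditive => //.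
  exact: bigcupT_measurable.
have [A /all_and3[mA EA An]] := choice coverE.
have mG : measurable (\bigcap_n A n) by exact: bigcapT_measurable.
have EG : E `<=` \bigcap_n A n by exact: sub_bigcap.
exists (\bigcap_n A n); split => //.
apply/eqP; rewrite eq_le; apply/andP; split; last first.
  by rewrite -(measurable_mu_extE mu mG) le_outer_measure.
apply/lee_addgt0Pr => _/posnumP[e]; near \oo => n.
apply: (@le_trans _ _ (mu (A n))).
  by apply: le_measure; rewrite ?inE//; exact: bigcap_inf.
apply: le_trans (An n) _; rewrite leeD// lee_fin ltW//.
by near: n; exact: near_infty_natSinv_lt.
Unshelve. all: by end_near. Qed.

(** Every set measurable for the completion of a sigma-finite measure contains a
    set of the original sigma-algebra of the same measure: on each piece [F n] of
    finite measure, remove a hull of [F n `\` A] from [F n]. *)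
Lemma caratheodory_kernel d (T : measurableType d) (R : realType)
    (mu : {measure set T -> \bar R}) (A : set T) :
  sigma_finite setT mu -> (mu^*%mu).-cara.-measurable A ->
  exists B, [/\ measurable B, B `<=` A & mu^*%mu A = mu B].
Proof.
move=> /sigma_finiteP[F [TF ndF Ffin]] mA.
have mF n : measurable (F n) by have [] := Ffin n.
have cF n : (mu^*%mu).-cara.-measurable (F n).
  exact: caratheodory_measurable_mu_ext.
have coverA (n : nat) : exists B : set T,
    [/\ measurable B, B `<=` A & (mu^*%mu (A `&` F n) <= mu B)%E].
  have FAfin : (mu^*%mu (F n `\` A) < +oo)%E.
    apply: (@le_lt_trans _ _ (mu (F n))); last exact: (Ffin n).2.
    have <- : mu^*%mu (F n) = mu (F n) by exact: measurable_mu_extE.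
    by apply: le_outer_measure; exact: subDsetl.
  have [G [mG FAG GE]] := outer_measure_hull FAfin.
  exists (F n `\` G); split; first exact: measurableD.
    by move=> x [Fx NGx]; apply: contrapT => NAx; apply: NGx; apply: FAG.
  have -> : mu^*%mu (A `&` F n) = (mu (F n) - mu^*%mu (F n `\` A))%E.
    have : mu^*%mu (F n) =
        (mu^*%mu (F n `&` A) + mu^*%mu (F n `&` ~` A))%E := mA (F n).
    rewrite -setDE measurable_mu_extE// setIC => ->.
    by rewrite addeK// ge0_fin_numE// outer_measure_ge0.
  rewrite -GE measureD//; last by have [] := Ffin n.
  apply: leeB => //; apply: le_measure; rewrite ?inE//.
  exact: measurableI.
have [B /all_and3[mB BA ABle]] := choice coverA.
have mUB : measurable (\bigcup_n B n) by exact: bigcupT_measurable.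
exists (\bigcup_n B n); split => //; first by move=> x [n _ /BA].
apply/eqP; rewrite eq_le; apply/andP; split; last first.
  by rewrite -(measurable_mu_extE mu mUB) le_outer_measure// => x [n _ /BA].
have cAF n : (mu^*%mu).-cara.-measurable (A `&` F n) by exact: measurableI.
have -> : A = \bigcup_n (A `&` F n) by rewrite -setI_bigcupr -TF setIT.
have cvgA : (mu^*%mu \o (fun n => A `&` F n)) @ \oo -->
    mu^*%mu (\bigcup_n (A `&` F n)).
  apply: (nondecreasing_cvg_mu
    (mu := completed_measure_extension (mu := mu))) => //.
    exact: bigcupT_measurable.
  by move=> m n mn; apply/subsetPset; apply: setIS; apply/subsetPset/ndF.
rewrite -(cvg_lim _ cvgA)//; apply: lime_le; first by apply/cvg_ex; exists (mu^*%mu (\bigcup_n (A `&` F n))).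
apply: nearW => n /=; apply: le_trans (ABle n) _.
by apply: le_measure; rewrite ?inE//; exact: bigcup_sup.
Qed.

(** * Rearrangement of Borel sets of the plane *)

Section plane.
Variable R : realType.
Notation T := (measurableTypeR R).
Notation mu := (@lebesgue_measure R).

Lemma product_lebesgueC (A : set (T * T)) : measurable A ->
  ((mu \x mu) A = (mu \x^ mu) A)%E.
Proof.
move=> mA; apply: product_measure_unique => // A1 A2 mA1 mA2.
exact: product_measure2E.
Qed.

Lemma lebesgue_measure_itv0 (y : \bar R) : (0 <= y)%E ->
  mu [set t : R | 0 < t /\ (t%:E < y)%E] = y.
Proof.
case: y => [y| |]//.
- rewrite lee_fin => y0.
  rewrite (_ : [set _ | _] = `]0, y[%classic); last first.
    apply/seteqP; split => t /=; rewrite in_itv/= lte_fin; last by move/andP.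
    by case=> -> ->.
  rewrite lebesgue_measure_itv/= lte_fin.
  move: y0; rewrite le_eqVlt => /predU1P[<-|->]; first by rewrite ltxx.
  by rewrite -EFinB subr0.
- move=> _; rewrite (_ : [set _ | _] = `]0, +oo[%classic); last first.
    apply/seteqP; split => t /=; rewrite in_itv/= ltry andbT; last by [].
    by case=> ->.
  by rewrite lebesgue_measure_itv/= ltry.
Qed.

(** The points strictly between the axis and the graph of [g]. *)
Definition subgraph (g : T -> \bar R) : set (T * T) :=
  [set z | 0 < z.2 /\ (z.2%:E < g z.1)%E].

Lemma measurable_subgraph (g : T -> \bar R) :
  measurable_fun setT g -> measurable (subgraph g).
Proof.
move=> mg.
have m2 : measurable_fun setT (fun z : T * T => (z.2%:E : \bar R)).
  by apply/measurable_EFinP; exact: measurable_snd.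
have mg1 : measurable_fun setT (fun z : T * T => g z.1).
  by apply: measurableT_comp => //; exact: measurable_fst.
have mc : measurable_fun setT (fun z : T * T => (0%:E : \bar R)) by [].
have -> : subgraph g = (setT `&` [set z | (0%:E < z.2%:E :> \bar R)%E]) `&`
    (setT `&` [set z | (z.2%:E < g z.1)%E]).
  apply/seteqP; split => z /=; rewrite lte_fin; first by case.
  by case=> -[_ ?] [_ ?].
by apply: measurableI; exact: measurable_lte.
Qed.

Lemma xsection_subgraph (g : T -> \bar R) x : (forall x, 0 <= g x)%E ->
  mu (xsection (subgraph g) x) = g x.
Proof.
move=> g0; rewrite -[RHS]lebesgue_measure_itv0//; congr (mu _).
by apply/seteqP; split => t; rewrite /xsection /= inE.
Qed.

Lemma measure_subgraph (g : T -> \bar R) : (forall x, 0 <= g x)%E ->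
  ((mu \x mu) (subgraph g) = \int[mu]_x g x)%E.
Proof.
by move=> g0; apply: eq_integral => x _; exact: xsection_subgraph.
Qed.

(** The reflection of a plane set in the diagonal. *)
Definition transpose (A : set (T * T)) : set (T * T) := [set z | A (z.2, z.1)].

Lemma measurable_transpose A : measurable A -> measurable (transpose A).
Proof.
move=> mA; rewrite -[transpose A]setTI.
by apply: (measurable_swap measurableT).
Qed.

Lemma ysection_transpose A y : ysection (transpose A) y = xsection A y.
Proof. by apply/seteqP; split => t; rewrite /xsection /ysection /= !inE. Qed.

Lemma measure_transpose (A : set (T * T)) : measurable A ->
  ((mu \x mu) (transpose A) = (mu \x mu) A)%E.
Proof.
move=> mA; rewrite product_lebesgueC; last exact: measurable_transpose.
by apply: eq_integral => y _ /=; rewrite ysection_transpose.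
Qed.

(** The function that sends [t > 0] to the measure of the set of the [x] such
    that the vertical section of [B] at [x] has measure greater than [t]; it
    vanishes for [t <= 0]. *)
Definition section_distr (B : set (T * T)) (t : T) : \bar R :=
  mu (ysection (subgraph (mu \o xsection B)) t).

(** The iterated rearrangement of [B], first in the second variable and then in
    the first one: the points [(a, b)] with [0 < a < section_distr B b]. *)
Definition set_rearrangement (B : set (T * T)) : set (T * T) :=
  transpose (subgraph (section_distr B)).

Lemma measurable_section_distr B : measurable B ->
  measurable_fun setT (section_distr B).
Proof.
move=> mB; apply: measurable_fun_ysection.
by apply: measurable_subgraph; exact: measurable_fun_xsection.
Qed.

Lemma measurable_set_rearrangement B : measurable B ->
  measurable (set_rearrangement B).
Proof.
move=> mB; apply: measurable_transpose; apply: measurable_subgraph.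
exact: measurable_section_distr.
Qed.

(** Rearranging preserves the area: each of the two one-dimensional
    rearrangements preserves the measure of the sections in one direction. *)
Lemma measure_set_rearrangement B : measurable B ->
  ((mu \x mu) (set_rearrangement B) = (mu \x mu) B)%E.
Proof.
move=> mB; rewrite measure_transpose; last first.
  by apply: measurable_subgraph; exact: measurable_section_distr.
rewrite measure_subgraph//.
transitivity ((mu \x mu) (subgraph (mu \o xsection B)))%E.
  rewrite product_lebesgueC//.
  by apply: measurable_subgraph; exact: (@measurable_fun_xsection _ _ T T R mu).
by rewrite measure_subgraph.
Qed.

End plane.

(** * Lebesgue measure and decreasing sets *)

Section lebesgue.
Variable R : realType.
Notation T := (measurableTypeR R).
Notation mu := (@lebesgue_measure R).

(** Both sides are the same outer measure, so this holds for every set. *)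
Lemma leb1E (A : set R) : leb1 R A = mu A.
Proof. by []. Qed.

Lemma sigma_finite_lebesgue2 : sigma_finite setT (mu \x mu)%E.
Proof.
have /sigma_finiteP[F [TF ndF Ffin]] := sigma_finiteT mu.
exists (fun n => F n `*` F n); last first.
  move=> n; have [mF Fn] := Ffin n; split; first exact: measurableX.
  by rewrite product_measure1E// lte_mul_pinfty// ge0_fin_numE.
apply/seteqP; split => // -[x y] _.
have [i _ Fx] : (\bigcup_i F i) x by rewrite -TF.
have [j _ Fy] : (\bigcup_i F i) y by rewrite -TF.
exists (maxn i j) => //; split => /=.
  by move: x Fx; apply/subsetPset/ndF/leq_maxl.
by move: y Fy; apply/subsetPset/ndF/leq_maxr.
Qed.

Lemma leb1_itv0 (y : \bar R) : (0 <= y)%E ->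
  leb1 R [set t : R | 0 < t /\ (t%:E < y)%E] = y.
Proof. exact: lebesgue_measure_itv0. Qed.

Lemma le_leb1 (A B : set R) : A `<=` B -> (leb1 R A <= leb1 R B)%E.
Proof. exact: (le_mu_ext (@wlength R idfun)). Qed.

Lemma le_leb2 (A B : set (R * R)) : A `<=` B -> (leb2 R A <= leb2 R B)%E.
Proof. exact: (le_mu_ext (mu \x mu)%E). Qed.

Lemma leb2E (A : set (T * T)) : measurable A -> (leb2 R A = (mu \x mu) A)%E.
Proof. exact: measurable_mu_extE. Qed.

Lemma measurable_lebR (A : set R) :
  measurable (A : set T) -> measurable (A : set (lebR R)).
Proof. exact: sub_caratheodory. Qed.

Lemma measurable_lebR2 (A : set (R * R)) :
  measurable (A : set (T * T)) -> measurable (A : set (lebR2 R)).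
Proof. exact: caratheodory_measurable_mu_ext. Qed.

Lemma leb1_setT : leb1 R setT = +oo%E.
Proof. by rewrite leb1E -set_itvNyy lebesgue_measure_itv. Qed.

Lemma leb2_setT : leb2 R setT = +oo%E.
Proof.
have muT : mu [set: T] = +oo%E := leb1_setT.
rewrite leb2E// -setXTT; transitivity (mu [set: T] * mu [set: T])%E.
  exact: product_measure1E.
by rewrite muT mulyy.
Qed.

Lemma measurable_pos : measurable (`]0, +oo[ : set (lebR R)).
Proof. by apply: measurable_lebR; exact: measurable_itv. Qed.

Lemma measurable_quadrant : measurable (@quadrant R : set (lebR2 R)).
Proof.
apply: measurable_lebR2.
rewrite (_ : @quadrant R = `]0, +oo[%classic `*` `]0, +oo[%classic).
  by apply: measurableX; exact: measurable_itv.
by apply/seteqP; split => -[a b]; rewrite /quadrant /= !in_itv/= !andbT.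
Qed.

Lemma decreasing_setsP (D : set (R * R)) : decreasing_sets D <->
  D `<=` @quadrant R /\ (forall a b a' b' : R, 0 < a -> 0 < b ->
    a <= a' -> b <= b' -> D (a', b') -> D (a, b)).
Proof.
split=> [[DQ D1 D2]|[DQ Ddown]].
  split=> // a b a' b' a0 b0 aa bb Dab.
  have h (P : set (R * R)) (z z' : R * R) :
      (\1_P z <= \1_P z' :> R) -> P z -> P z'.
    rewrite !indicE => + Pz; rewrite mem_set//.
    by case: (boolP (z' \in P)) => [/set_mem//|]; rewrite ler10.
  by apply: (h _ _ _ (D1 a a' b a0 aa b0));
    apply: (h _ _ _ (D2 a' b b' (lt_le_trans a0 aa) b0 bb)).
split=> // [x x' y x0 xx y0|x y y' x0 y0 yy]; rewrite !indicE ler_nat;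
  case: (boolP ((_, _) \in D)) => // /set_mem Dz; rewrite mem_set//;
  [exact: (Ddown _ _ _ _ x0 y0 xx (lexx y) Dz)|
   exact: (Ddown _ _ _ _ x0 y0 (lexx x) yy Dz)].
Qed.

(** A decreasing set differs from the Borel set of the points [(a, b)] with
    [0 < a < m b], where [m b] is the length of its horizontal section at height
    [b], by a part of the graph of [m], which is null. *)
Lemma measurable_decreasing (D : set (R * R)) :
  decreasing_sets D -> measurable (D : set (lebR2 R)).
Proof.
move=> /decreasing_setsP[DQ Ddown].
pose m (b : T) : \bar R := mu (ysection D b).
have m0 b : (0 <= m b)%E by exact: outer_measure_ge0.
have m_pos b : (0 < m b)%E -> 0 < b.
  move=> mb; have : ysection D b !=set0.
    by apply/set0P; apply: contraTneq mb => Db; rewrite /m Db measure0 ltxx.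
  by case=> a; rewrite /ysection /= inE => /DQ[].
(* [m] is nonincreasing on the positive half-line and zero elsewhere, so the
   sets [{c < m}] are intervals *)
have mm : measurable_fun setT m.
  apply: (measurability _ (ErealGenOInfty.measurableE R)) => //.
  move=> _ [_ [c ->] <-]; rewrite setTI; apply: is_interval_measurable.
  move=> x y /=; rewrite !in_itv/= !andbT => cx cy z /andP[xz zy].
  rewrite in_itv/= andbT.
  have [c0|c0] := ltP c 0; first by apply: lt_le_trans (m0 z).
  have x0 : 0 < x by apply: m_pos; apply: le_lt_trans cx; rewrite lee_fin.
  apply: lt_le_trans cy _; apply: le_leb1 => a.
  rewrite /ysection /= !inE => Day; have [/= a0 _] := DQ _ Day.
  exact: (Ddown _ _ _ _ a0 (lt_le_trans x0 xz) (lexx a) zy Day).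
pose L : set (T * T) := transpose (subgraph m).
have mL : measurable L by apply: measurable_transpose; exact: measurable_subgraph.
have LD : L `<=` D.
  move=> [a b] [/= a0 am].
  have [a' [aa' Da']] : exists a', a <= a' /\ D (a', b).
    apply: contrapT => /forallNP h.
    suff : (m b <= a%:E)%E by rewrite leNgt am.
    rewrite -[leRHS]lebesgue_measure_itv0; last by rewrite lee_fin ltW.
    apply: le_leb1 => t; rewrite /ysection /= inE => Dt; split.
      by case: (DQ _ Dt).
    by rewrite lte_fin ltNge; apply/negP => at_; exact: (h t).
  have [/= _ b0] := DQ _ Da'.
  exact: (Ddown _ _ _ _ a0 b0 aa' (lexx b) Da').
pose Z : set (T * T) := [set z | z.1%:E = m z.2].
have mZ : measurable Z.
  have m1 : measurable_fun setT (fun z : T * T => (z.1%:E : \bar R)).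
    by apply/measurable_EFinP; exact: measurable_fst.
  have m2 : measurable_fun setT (fun z : T * T => m z.2).
    by apply: measurableT_comp => //; exact: measurable_snd.
  by rewrite -[Z]setTI; exact: (measurable_eqe measurableT m1 m2).
have Z0 : ((mu \x mu) Z = 0)%E.
  rewrite product_lebesgueC//; apply: integral0_eq => b _ /=.
  apply/eqP; rewrite eq_le measure_ge0 andbT.
  rewrite -(lebesgue_measure_set1 (fine (m b))).
  by apply: le_leb1 => a; rewrite /ysection /= inE /Z/= => <-.
have DLZ : D `\` L `<=` Z.
  move=> [a b] [Dab NL]; have [/= a0 b0] := DQ _ Dab.
  apply/eqP; rewrite /= eq_le; apply/andP; split; last first.
    by rewrite leNgt; apply/negP => am; exact: NL.
  rewrite -[leLHS]lebesgue_measure_itv0; last by rewrite lee_fin ltW.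
  apply: le_leb1 => t [t0]; rewrite lte_fin => ta.
  by rewrite /ysection /= inE; exact: (Ddown _ _ _ _ t0 b0 (ltW ta) (lexx b) Dab).
rewrite -(setDUK LD); apply: measurableU; first exact: measurable_lebR2.
apply: measure_is_complete_caratheodory.
exists Z; split => //; first exact: measurable_lebR2.
by rewrite -[RHS]Z0; exact: measurable_mu_extE.
Qed.

Lemma set_rearrangement_decreasing (B : set (T * T)) :
  decreasing_sets (set_rearrangement B).
Proof.
have bpos t : (0 < section_distr B t)%E -> 0 < t.
  move=> mt; rewrite ltNge; apply/negP => t0; move: mt; rewrite /section_distr.
  rewrite (_ : ysection _ _ = set0) ?measure0 ?ltxx//.
  apply/seteqP; split => // x; rewrite /ysection /= inE => -[/=].
  by rewrite ltNge t0.
apply/decreasing_setsP; split=> [[a b] [/= a0 ab]|a b a' b' a0 b0 aa bb].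
  by split => //=; apply: bpos; apply: lt_trans ab; rewrite lte_fin.
move=> [/= a'0 ab']; split => //=.
apply: (@le_lt_trans _ _ a'%:E); first by rewrite lee_fin.
apply: lt_le_trans ab' _; apply: le_leb1 => x.
rewrite /ysection /= !inE => -[/= b'0 bx]; split => //=.
by apply: le_lt_trans bx; rewrite lee_fin.
Qed.

(** * Rearrangements and level sets *)

Lemma rearrangement_ge (X : Type) (m : set X -> \bar R) (f : X -> \bar R)
    (P : set X) (s t : R) :
  {homo m : A B / A `<=` B >-> (A <= B)%E} ->
  P `<=` [set x | (s%:E <= `|f x|)%E] -> (t%:E < m P)%E ->
  (s%:E <= rearrangement m f t)%E.
Proof.
move=> mle Ps tP; apply: le_ereal_inf_tmp => _ [s' /= fs' <-].
rewrite lee_fin leNgt; apply/negP => s's.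
suff : (m P <= t%:E)%E by rewrite leNgt tP.
apply: le_trans fs'; apply: mle => x /Ps /=; apply: lt_le_trans.
by rewrite lte_fin.
Qed.

Lemma rearrangement_le (X : Type) (m : set X -> \bar R) (f : X -> \bar R)
    (s t : R) :
  (m [set x | (s%:E < `|f x|)%E] <= t%:E)%E -> (rearrangement m f t <= s%:E)%E.
Proof. by move=> h; apply: ereal_inf_lbound; exists s. Qed.

Lemma rearrangement_ge0 (X : Type) (m : set X -> \bar R) (f : X -> \bar R)
    (t : R) :
  {homo m : A B / A `<=` B >-> (A <= B)%E} -> m setT = +oo%E ->
  (0 <= rearrangement m f t)%E.
Proof.
move=> mle mT; apply: (rearrangement_ge (P := setT)) => [//|x _ /=|];
  [exact: abse_ge0|by rewrite mT ltry].
Qed.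

(** For [B] inside a level set, only the weak inequality is claimed: it follows
    from monotonicity of outer measure alone, although the sections of [f] may be
    non-measurable. *)
Lemma set_rearrangement_sub (f : R * R -> R) (B : set (T * T)) (s : R)
    (z : R * R) :
  B `<=` [set z | s < `|f z|] -> set_rearrangement B z ->
  (s%:E <= rearrangement_yx f z.1 z.2)%E.
Proof.
move=> Bs; case: z => a b [/= a0 ab].
apply: (rearrangement_ge le_leb1 _ ab) => x.
rewrite /ysection /= inE => -[/= b0 bx].
apply: le_trans (lee_abs _).
apply: (rearrangement_ge le_leb1 _ bx) => y.
by rewrite /xsection /= inE => /Bs /= /ltW; rewrite lee_fin.
Qed.

(** The set [D] is the rearrangement of a Borel kernel of the level set of [f],
    so that the sections met in the computation of its area are all Borel. *)
Lemma level_set_rearrangement (f : R * R -> R) (s : R) :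
  measurable_fun setT (f : lebR2 R -> R) ->
  exists D : set (R * R), [/\ decreasing_sets D,
    leb2 R D = leb2 R [set z | s < `|f z|] &
    forall z, D z -> (s%:E <= rearrangement_yx f z.1 z.2)%E].
Proof.
move=> mf.
have mE : measurable ([set z | s < `|f z|] : set (lebR2 R)).
  have mnf : measurable_fun setT (fun z : lebR2 R => `|f z|).
    exact: measurableT_comp.
  rewrite -[X in measurable X]setTI.
  rewrite (_ : [set z | s < `|f z|] = (fun z => `|f z|) @^-1` `]s, +oo[).
    by apply: mnf.
  by apply/seteqP; split => z /=; rewrite in_itv/= andbT.
have [B [mB BE EB]] :=
  caratheodory_kernel sigma_finite_lebesgue2 mE.
exists (set_rearrangement B); split.
- exact: set_rearrangement_decreasing.
- rewrite leb2E; last exact: measurable_set_rearrangement.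
  by rewrite measure_set_rearrangement// -EB.
- by move=> z; exact: set_rearrangement_sub.
Qed.

End lebesgue.

(** * Necessity: indicators of decreasing sets *)

Section necessity.
Variable R : realType.
Implicit Types (D : set (R * R)) (p q c : R) (u : R -> R) (w : R * R -> R).

Lemma rearrangement_indic_ge D (t : R) : (t%:E < leb2 R D)%E ->
  (1 <= rearrangement (leb2 R) (EFin \o (\1_D : R * R -> R)) t)%E.
Proof.
apply: (rearrangement_ge (@le_leb2 R)) => z Dz /=.
by rewrite indicE mem_set// normr1.
Qed.

Lemma rearrangement_y_indic_le1 D (x t : R) : 0 < t ->
  (0 <= rearrangement_y (\1_D : R * R -> R) x t <= 1)%E.
Proof.
move=> t0; apply/andP; split.
  exact: rearrangement_ge0 (@le_leb1 R) (leb1_setT R).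
apply: rearrangement_le; rewrite [X in leb1 R X](_ : _ = set0).
  by rewrite measure0 lee_fin ltW.
apply/seteqP; split => y //=; rewrite lte_fin indicE.
by case: (_ \in _); rewrite ?normr1 ?normr0 ?ltxx// ltr10.
Qed.

Lemma rearrangement_y_indic_gt0 D (x t : R) : decreasing_sets D -> 0 < t ->
  (0 < rearrangement_y (\1_D : R * R -> R) x t)%E -> D (x, t).
Proof.
move=> /decreasing_setsP[DQ Ddown] t0; apply: contraPP => NDt.
apply/negP; rewrite -leNgt; apply: rearrangement_le.
rewrite -[leRHS]leb1_itv0; last by rewrite lee_fin ltW.
apply: le_leb1 => y /=; rewrite lte_fin indicE.
case: (boolP (_ \in D)) => [/set_mem Dy _|_]; last by rewrite normr0 ltxx.
have [/= x0 y0] := DQ _ Dy; split => //; rewrite lte_fin ltNge.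
by apply/negP => ty; apply: NDt; exact: (Ddown _ _ _ _ x0 t0 (lexx x) ty Dy).
Qed.

(** The indicator of a decreasing set dominates its own iterated rearrangement. *)
Lemma rearrangement_yx_indic_le D (z : R * R) : decreasing_sets D ->
  quadrant z ->
  (0 <= rearrangement_yx (\1_D : R * R -> R) z.1 z.2 <= (\1_D z)%:E)%E.
Proof.
move=> Ddec; case: z => s t [/= s0 t0]; apply/andP; split.
  exact: rearrangement_ge0 (@le_leb1 R) (leb1_setT R).
have [DQ Ddown] := (decreasing_setsP D).1 Ddec.
have ry0 x : (0 <= rearrangement_y (\1_D : R * R -> R) x t <= 1)%E.
  exact: rearrangement_y_indic_le1.
apply: rearrangement_le; rewrite indicE; case: (boolP (_ \in D)) => [_|/negP NDz].
  rewrite [X in leb1 R X](_ : _ = set0).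
    by rewrite measure0 lee_fin ltW.
  apply/seteqP; split => x //=; have /andP[r0 r1] := ry0 x.
  by rewrite gee0_abs// ltNge r1.
rewrite -[leRHS]leb1_itv0; last by rewrite lee_fin ltW.
apply: le_leb1 => x /=; have /andP[r0 _] := ry0 x.
rewrite gee0_abs// => /(rearrangement_y_indic_gt0 Ddec t0) Dxt.
have [/= x0 _] := DQ _ Dxt; split => //; rewrite lte_fin ltNge.
apply/negP => sx; apply: NDz; apply/mem_set.
exact: (Ddown _ _ _ _ s0 t0 sx (lexx t) Dxt).
Qed.

Lemma norm_Lambda_indic_ge q u D : 0 < q -> weight1 u ->
  ((\int[leb1 R]_(t in [set t : R | (0 < t)%R /\ (t%:E < leb2 R D)%E])
     (u t)%:E) `^ q^-1 <= norm_Lambda q u \1_D)%E.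
Proof.
move=> q0 [u0 meas_u _]; apply: le_poweR; first by rewrite invr_ge0 ltW.
  by apply: integral_ge0 => t [t0 _]; rewrite lee_fin u0.
rewrite integral_mkcond [leRHS]integral_mkcond.
apply: le_integral_ge0 => t _; rewrite /patch.
  by case: ifPn => // /set_mem [t0 _]; rewrite lee_fin u0.
case: ifPn => [/set_mem [t0 tD]|_]; last first.
  case: ifPn => // /set_mem /=; rewrite in_itv/= andbT => t0.
  by rewrite mule_ge0 ?poweR_ge0// lee_fin u0.
rewrite mem_set/=; last by rewrite in_itv/= t0.
rewrite -[leLHS]mul1e; apply: lee_wpmul2r; first by rewrite lee_fin u0.
rewrite -[leLHS](poweR1r q); apply: le_poweR => //; first exact: ltW.
exact: rearrangement_indic_ge.
Qed.

Lemma norm_Lambda2_indic_le p w D : 0 < p -> weight2 w -> decreasing_sets D ->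
  (norm_Lambda2 p w \1_D <= (\int[leb2 R]_(z in D) (w z)%:E) `^ p^-1)%E.
Proof.
move=> p0 [w0 meas_w _] Ddec; have [DQ _] := (decreasing_setsP D).1 Ddec.
apply: le_poweR; first by rewrite invr_ge0 ltW.
  by apply: integral_ge0 => z Qz; rewrite mule_ge0 ?poweR_ge0// lee_fin w0.
rewrite integral_mkcond [leRHS]integral_mkcond.
apply: le_integral_ge0 => z _; rewrite /patch.
  by case: ifPn => // /set_mem Qz; rewrite mule_ge0 ?poweR_ge0// lee_fin w0.
case: ifPn => [/set_mem Qz|NQ]; last first.
  by case: ifPn => // /set_mem /DQ Qz; rewrite mem_set in NQ.
have /andP[r0 r1] := rearrangement_yx_indic_le Ddec Qz.
have := le_poweR (ltW p0) r0 r1; rewrite indicE.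
case: ifPn => Dz rp.
  rewrite poweR1r in rp.
  by rewrite -[leRHS]mul1e lee_wpmul2r// lee_fin w0.
rewrite poweR0r ?gt_eqF// in rp.
have -> : (rearrangement_yx \1_D z.1 z.2 `^ p = 0)%E.
  by apply/eqP; rewrite eq_le rp poweR_ge0.
by rewrite mul0e.
Qed.

Lemma ratio_sup_le p q u w c : 0 < p -> 0 < q -> weight1 u -> weight2 w ->
  embedding_constant p q u w c -> (ratio_sup p q u w <= c%:E)%E.
Proof.
move=> p0 q0 hu hw [c0 sub emb]; apply: ge_ereal_sup => _ [D Ddec <-].
set U := integral _ _ _; set W := integral _ _ _.
have W0 : (0 <= W)%E.
  have [DQ _] := (decreasing_setsP D).1 Ddec; have [w0 _ _] := hw.
  by apply: integral_ge0 => z /DQ Qz; rewrite lee_fin w0.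
(* a set of infinite weight contributes the ratio zero *)
have [Woo|Woo] := eqVneq W +oo%E.
  by rewrite Woo poweRyr ?invr_eq0 ?gt_eqF// invey mule0 lee_fin.
have Wp : (W `^ p^-1 < +oo)%E by rewrite poweR_lty// ltey.
rewrite lee_divr ?poweR_ge0//.
have nle : (norm_Lambda2 p w \1_D <= W `^ p^-1)%E by exact: norm_Lambda2_indic_le.
have D2 : Lambda2 p w \1_D.
  split; last exact: le_lt_trans nle Wp.
  by apply: measurable_indic; exact: measurable_decreasing.
apply: le_trans (norm_Lambda_indic_ge D q0 hu) _.
by apply: le_trans (emb _ D2) _; apply: lee_wpmul2l.
Qed.

End necessity.

(** * Sufficiency *)

Section sufficiency.
Variable R : realType.
Variables (p q c : R) (u : R -> R) (w : R * R -> R).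
Hypotheses (p0 : 0 < p) (pq : p <= q) (c0 : 0 <= c).
Hypotheses (hu : weight1 u) (hw : weight2 w).
Hypothesis hc : (ratio_sup p q u w <= c%:E)%E.

Let q0 : 0 < q. Proof. exact: lt_le_trans pq. Qed.

Let weight_ge0 D : decreasing_sets D ->
  (0 <= \int[leb2 R]_(z in D) (w z)%:E)%E.
Proof.
move=> /decreasing_setsP[DQ _]; have [w0 _ _] := hw.
by apply: integral_ge0 => z /DQ Qz; rewrite lee_fin w0.
Qed.

Lemma decreasing_set_bound D : decreasing_sets D ->
  (\int[leb2 R]_(z in D) (w z)%:E < +oo)%E ->
  ((\int[leb1 R]_(t in [set t : R | (0 < t)%R /\ (t%:E < leb2 R D)%E])
      (u t)%:E) `^ (q / p)^-1 <=
   (c `^ p)%:E * \int[leb2 R]_(z in D) (w z)%:E)%E.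
Proof.
move=> Ddec Wfin; have W0 := weight_ge0 Ddec.
set U := integral _ _ _; set W := integral _ _ _.
have : (U `^ q^-1 <= c%:E * W `^ p^-1)%E.
  rewrite -lee_divr ?poweR_ge0// ?poweR_lty//.
  by apply: le_trans hc; apply: ereal_sup_ubound; exists D.
move=> /(le_poweR (ltW p0) (poweR_ge0 _ _)).
rewrite -poweRrM invf_div mulrC poweRM ?poweR_ge0 ?lee_fin//.
by rewrite poweR_EFin poweRKV ?gt_eqF.
Qed.

(** This is [level_set_embedding] with exponent [q / p] and constant [c `^ p],
    applied to the [p]-th powers of the two rearrangements of [f]. *)
Lemma norm_Lambda_le f : Lambda2 p w f ->
  (norm_Lambda q u f <= c%:E * norm_Lambda2 p w f)%E.
Proof.
move=> [mf f2]; have [u0 meas_u _] := hu; have [w0 meas_w _] := hw.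
pose S : set R := `]0, +oo[%classic.
pose g t := rearrangement (leb2 R) (EFin \o f) t.
pose H (z : R * R) := (rearrangement_yx f z.1 z.2 `^ p)%E.
(* the restriction makes [F] vanish for nonpositive [t], where the rearrangement
   is not meant to be evaluated *)
pose F : R -> \bar R := ((fun t => g t `^ p) \_ S)%E.
pose I := (\int[leb2 R]_(z in @quadrant R) (H z * (w z)%:E))%E.
have g0 t : (0 <= g t)%E.
  exact: rearrangement_ge0 (@le_leb2 R) (leb2_setT R).
have H0 z : (0 <= H z)%E by exact: poweR_ge0.
have F0 t : (0 <= F t)%E.
  by rewrite /F /patch; case: ifPn => // _; exact: poweR_ge0.
have I0 : (0 <= I)%E.
  by apply: integral_ge0 => z Qz; rewrite mule_ge0// lee_fin w0.
have Ifin : (I < +oo)%E.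
  by apply: (@lty_poweRy _ _ p^-1) f2; rewrite invr_eq0 gt_eqF.
have [D /all_and3[Ddec DE DH]] := choice (fun s : R =>
  level_set_rearrangement (s `^ p^-1) mf).
have mD s : measurable (D s : set (lebR2 R)) by exact: measurable_decreasing.
have DQ s : D s `<=` @quadrant R.
  by have [] := (decreasing_setsP (D s)).1 (Ddec s).
pose J s := [set t : R | 0 < t /\ (t%:E < leb2 R (D s))%E].
have JS s : J s `<=` S by move=> t [t0 _]; rewrite /S /= in_itv/= t0.
have mJ s : measurable (J s : set (lebR R)).
  apply: measurable_lebR; apply: is_interval_measurable.
  move=> x y [x0 _] [_ yD] z /andP[xz zy]; split; first exact: lt_le_trans xz.
  by apply: le_lt_trans yD; rewrite lee_fin.
have sK s : 0 < s -> (s `^ p^-1) `^ p = s.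
  by move=> s0; apply: powRKV; [exact: ltW|rewrite gt_eqF].
have DH' s z : 0 < s -> D s z -> (s%:E <= H z)%E.
  move=> s0 /DH /(le_poweR (ltW p0)); rewrite lee_fin powR_ge0 => /(_ isT).
  by rewrite poweR_EFin sK.
have FJ s t : 0 < s -> (s%:E < F t)%E -> J s t.
  move=> s0; rewrite /F /patch; case: ifPn => [/set_mem|_]; last first.
    by rewrite lte_fin ltNge ltW.
  rewrite /S /= in_itv/= andbT => t0 sg; split => //.
  rewrite ltNge DE; apply/negP => Es.
  have : (g t <= (s `^ p^-1)%:E)%E by exact: rearrangement_le.
  move=> /(le_poweR (ltW p0) (g0 t)).
  by rewrite poweR_EFin sK// leNgt sg.
(* needed because the ratio of a set of infinite weight is zero and bounds nothing *)
have Wfin s : 0 < s -> (\int[leb2 R]_(z in D s) (w z)%:E < +oo)%E.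
  move=> s0; rewrite ltey; apply/eqP => Woo.
  suff : (s%:E * \int[leb2 R]_(z in D s) (w z)%:E <= I)%E.
    by rewrite Woo gt0_muley ?lte_fin// leye_eq => /eqP Ioo; rewrite Ioo in Ifin.
  rewrite -ge0_integralZl_EFin//; last 3 first.
  - by move=> z /DQ Qz; rewrite lee_fin w0.
  - by apply/measurable_EFinP; apply: measurable_funS meas_w => //; exact: measurable_quadrant.
  - exact: ltW.
  rewrite integral_mkcond /I [leRHS]integral_mkcond.
  apply: le_integral_ge0 => z _; rewrite /patch.
    by case: ifPn => // /set_mem /DQ Qz; rewrite mule_ge0 ?lee_fin ?w0// ltW.
  case: ifPn => [/set_mem Dz|_].
    have Qz := DQ _ _ Dz; rewrite mem_set// lee_wpmul2r ?lee_fin ?w0//.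
    exact: DH' Dz.
  by case: ifPn => // /set_mem Qz; rewrite mule_ge0// lee_fin w0.
pose u' := u \_ S; pose w' := w \_ (@quadrant R).
have mu' : measurable_fun setT (u' : lebR R -> R).
  exact: (measurable_restrictT _ (@measurable_pos R)).1.
have meas_w' : measurable_fun setT (w' : lebR2 R -> R).
  exact: (measurable_restrictT _ (@measurable_quadrant R)).1.
have u'0 t : 0 <= u' t.
  rewrite /u' /patch; case: ifPn => // /set_mem.
  by rewrite /S /= in_itv/= andbT => /u0.
have w'0 z : 0 <= w' z.
  by rewrite /w' /patch; case: ifPn => // /set_mem /w0.
have r1 : 1 <= q / p by rewrite ler_pdivlMr// mul1r.
have JD s : 0 < s -> ((\int[leb1 R]_(t in J s) (u' t)%:E) `^ (q / p)^-1 <=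
    (c `^ p)%:E * \int[leb2 R]_(z in D s) (w' z)%:E)%E.
  move=> s0; rewrite (eq_integral (fun t : lebR R => (u t)%:E)); last first.
    by move=> t /set_mem/JS St; rewrite /u' /patch mem_set.
  rewrite [X in (_ <= _ * X)%E](eq_integral (fun z : lebR2 R => (w z)%:E)); last first.
    by move=> z /set_mem/DQ Qz; rewrite /w' /patch mem_set.
  by apply: decreasing_set_bound => //; exact: Wfin.
have := level_set_embedding r1 (powR_ge0 c p) mu' meas_w' u'0 w'0 F0 H0
  (fun s _ => mJ s) (fun s _ => mD s) FJ DH' JD.
have -> : (\int[leb2 R]_z (H z * (w' z)%:E) = I)%E.
  rewrite /I [RHS]integral_mkcond; apply: eq_integral => z _.
  by rewrite /w' /patch; case: ifPn => // _; rewrite mule0.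
have -> : (\int[leb1 R]_t (F t `^ (q / p) * (u' t)%:E) =
    \int[leb1 R]_(t in S) (g t `^ q * (u t)%:E))%E.
  rewrite [RHS]integral_mkcond; apply: eq_integral => t _.
  rewrite /F /u' /patch; case: ifPn => _; last by rewrite mule0.
  by rewrite -poweRrM mulrC divfK ?gt_eqF.
have pV0 : 0 <= p^-1 by rewrite invr_ge0 ltW.
move=> /(le_poweR pV0 (poweR_ge0 _ _)).
rewrite -poweRrM invf_div mulrAC divff ?gt_eqF// mul1r poweRM ?lee_fin ?powR_ge0//.
by rewrite poweR_EFin powRVK ?gt_eqF.
Qed.

Lemma ratio_embedding_constant : embedding_constant p q u w c.
Proof.
split=> [//|f f2|f]; last exact: norm_Lambda_le.
have [mf ffin] := f2; split=> //; apply: le_lt_trans (norm_Lambda_le f2) _.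
by rewrite lte_mul_pinfty ?lee_fin// ?poweR_ge0.
Qed.

End sufficiency.

Lemma ratio_sup_ge0 (R : realType) (p q : R) (u : R -> R) (w : R * R -> R) :
  (0 <= ratio_sup p q u w)%E.
Proof.
rewrite /ratio_sup; set Q := (X in ereal_sup X).
have [x Qx x0] : exists2 x, Q x & (0 <= x)%E.
  eexists; first by exists set0 => //; split=> // *; rewrite !indic0.
  by rewrite mule_ge0 ?inve_ge0 ?poweR_ge0.
exact: le_trans x0 (ereal_sup_ubound Qx).
Qed.

Theorem theorem3p2 (R : realType) (p q : R) (u : R -> R) (w : R * R -> R)
    (hp : 0 < p) (hpq : p <= q) (hu : weight1 u) (hw : weight2 w) :
  (embedding p q u w <-> (ratio_sup p q u w < +oo)%E) /\
  ((ratio_sup p q u w < +oo)%E ->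
     best_constant p q u w (ratio_sup p q u w)).
Proof.
have hq : 0 < q by exact: lt_le_trans hpq.
have C0 := ratio_sup_ge0 p q u w.
have best : (ratio_sup p q u w < +oo)%E ->
    best_constant p q u w (ratio_sup p q u w).
  move=> Cfin; have CE : ratio_sup p q u w = (fine (ratio_sup p q u w))%:E.
    by rewrite fineK// ge0_fin_numE.
  exists (fine (ratio_sup p q u w)) => //; split.
    by apply: ratio_embedding_constant => //; rewrite ?fine_ge0// -CE.
  by move=> c' emb; rewrite -lee_fin -CE; exact: ratio_sup_le emb.
split=> //; split=> [[c emb]|/best[c _ [emb _]]]; last by exists c.
exact: le_lt_trans (ratio_sup_le hp hq hu hw emb) (ltry _).
Qed.
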